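(* Let $0<\beta<1$ and $\alpha>0$, and consider the differential system $$x'=y,\qquad y'=z^2\sin x\cos x-\sin x-\varepsilon y,\qquad z'=\alpha(\cos x-\beta)$$ restricted to $\varepsilon=\varepsilon_c=2\alpha\beta^{3/2}$, at its equilibrium $P_0=(\arccos\beta,0,\beta^{-1/2})$. The second Lyapunov coefficient $l_2$ at $P_0$ (as defined in the context) is given by $$l_2(\beta,\alpha,\varepsilon_c)=\frac{\alpha\,\beta^{3/2}\,h(\beta,\alpha,\varepsilon_c)}{36\,(1-\beta^2+\alpha^2\beta^4)^3\,(9-9\beta^2+4\alpha^2\beta^4)\,(1-\beta^2+4\alpha^2\beta^4)^3},$$ where $$\begin{aligned} h(\beta,\alpha,\varepsilon_c)={}&-162-54(-9+37\alpha^2)\beta^2-9(-126+61\alpha^2+60\alpha^4)\beta^4\\ &-18(405-3212\alpha^2+1128\alpha^4)\beta^6\\ &+(13770-210843\alpha^2+113612\alpha^4-5533\alpha^6)\beta^8\\ &-6(2133-57687\alpha^2+38218\alpha^4+5186\alpha^6)\beta^{10}\\ &+(5994-301275\alpha^2+215340\alpha^4+284264\alpha^6-16022\alpha^8)\beta^{12}\\ &+2(-567+67878\alpha^2-45196\alpha^4-379430\alpha^6+9347\alpha^8)\beta^{14}\\ &+\alpha^2(-25029+9540\alpha^2+990831\alpha^4+155856\alpha^6-21205\alpha^8)\beta^{16}\\ &+4\alpha^4\bigl(513-\alpha^2(163340+120616\alpha^2-16768\alpha^4)\bigr)\beta^{18}\\ &-2\alpha^6(-86887-258835\alpha^2+30173\alpha^4+7208\alpha^6)\beta^{20}\\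 &+2\alpha^8(-96867-8956\alpha^2+23208\alpha^4)\beta^{22}\\ &+\alpha^{10}(33671-58288\alpha^2-4880\alpha^4)\beta^{24}\\ &+16\alpha^{12}(1603+718\alpha^2)\beta^{26}-16\alpha^{14}(453+40\alpha^2)\beta^{28}+640\alpha^{16}\beta^{30}. \end{aligned}$$
   Context: Write the system as $\mathbf{x}'=f(\mathbf{x},\mu)$ with $\mathbf{x}=(x,y,z)$, $x\in(0,\pi/2)$, $y\in\mathbb{R}$, $z\ge 0$, $\mu=(\beta,\alpha,\varepsilon)\in(0,1)\times(0,\infty)\times(0,\infty)$. For $\varepsilon=\varepsilon_c=2\alpha\beta^{3/2}$ the Jacobian matrix $A$ of $f$ at $P_0$ has eigenvalues $-\varepsilon_c$ and $\pm i\omega_0$, where $\omega_0=\sqrt{(1-\beta^2)/\beta}$. Let $B,C,D,E$ be the symmetric multilinear maps given by the partial derivatives of $f(\cdot,\mu)$ of order $2,3,4,5$ at $P_0$, extended complex-multilinearly to $\mathbb{C}^3$, so that $f(P_0+\mathbf{x},\mu)=A\mathbf{x}+\frac12B(\mathbf{x},\mathbf{x})+\frac16C(\mathbf{x},\mathbf{x},\mathbf{x})+\frac1{24}D(\mathbf{x},\mathbf{x},\mathbf{x},\mathbf{x})+\frac1{120}E(\mathbf{x},\mathbf{x},\mathbf{x},\mathbf{x},\mathbf{x})+\cdots$. Let $I$ be the $3\times3$ identity matrix and $\langle u,v\rangle=\sum_i\bar u_iv_i$. Put $$q=\Bigl(-i,\ \omega_0,\ \frac{\varepsilon_c}{2\beta}\Bigr),\qquad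 p=\Bigl(-\frac i2,\ \frac{\omega_0-i\varepsilon_c}{2(\omega_0^2+\varepsilon_c^2)},\ \frac{\beta(\varepsilon_c+i\omega_0)}{\omega_0^2+\varepsilon_c^2}\Bigr),$$ which satisfy $Aq=i\omega_0q$, $A^{\top}p=-i\omega_0p$, $\langle p,q\rangle=1$. Define successively $h_{11}=-A^{-1}B(q,\bar q)$; $h_{20}=(2i\omega_0I-A)^{-1}B(q,q)$; $h_{30}=(3i\omega_0I-A)^{-1}[3B(q,h_{20})+C(q,q,q)]$; $G_{21}=\langle p,\ C(q,q,\bar q)+B(\bar q,h_{20})+2B(q,h_{11})\rangle$; $h_{21}$ = the unique solution of $(i\omega_0I-A)h_{21}=C(q,q,\bar q)+B(\bar q,h_{20})+2B(q,h_{11})-G_{21}q$ with $\langle p,h_{21}\rangle=0$; $h_{31}=(2i\omega_0I-A)^{-1}[3B(q,h_{21})+B(\bar q,h_{30})+3B(h_{20},h_{11})+3C(q,q,h_{11})+3C(q,\bar q,h_{20})+D(q,q,q,\bar q)-3G_{21}h_{20}]$; $h_{22}=-A^{-1}[D(q,q,\bar q,\bar q)+4C(q,\bar q,h_{11})+C(\bar q,\bar q,h_{20})+C(q,q,\bar h_{20})+2B(h_{11},h_{11})+2B(q,\bar h_{21})+2B(\bar q,h_{21})+B(\bar h_{20},h_{20})]$; $G_{32}=\langle p,\ 6B(h_{11},h_{21})+B(\bar h_{20},h_{30})+3B(\bar h_{21},h_{20})+3B(q,h_{22})+2B(\bar q,h_{31})+6C(q,h_{11},h_{11})+3C(q,\bar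 h_{20},h_{20})+3C(q,q,\bar h_{21})+6C(q,\bar q,h_{21})+6C(\bar q,h_{20},h_{11})+C(\bar q,\bar q,h_{30})+D(q,q,q,\bar h_{20})+6D(q,q,\bar q,h_{11})+3D(q,\bar q,\bar q,h_{20})+E(q,q,q,\bar q,\bar q)\rangle$. The second Lyapunov coefficient is, by definition, $l_2=\frac1{12}\operatorname{Re}G_{32}$, with these formulas used for all $(\beta,\alpha)$ (in $h_{22}$ no term $-2h_{11}(G_{21}+\bar G_{21})$ is included, since it vanishes when $\operatorname{Re}G_{21}=0$). *)

(* Defs.v *)
From HB Require Import structures.
From mathcomp Require Import all_boot all_order all_algebra.
From mathcomp Require Import complex.
From mathcomp Require Import all_classical all_reals all_analysis.

Set Implicit Arguments.
Unset Strict Implicit.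
Unset Printing Implicit Defensive.

Import Order.TTheory GRing.Theory Num.Theory.
Import numFieldNormedType.Exports.

Local Open Scope ring_scope.

(* Points of the real phase space are row vectors, as required by the library
   Jacobian ['J f x], which acts on row vectors from the right. Complex vectors
   are columns, on which the transpose of ['J f x], i.e. the usual Jacobian
   matrix with (i, j) entry df_i/dx_j, acts from the left. *)

Section VectorField.
Context {R : realType}.
Implicit Types (beta alpha eps : R).

Definition vf beta alpha eps (X : 'rV[R]_3) : 'rV[R]_3 :=
  let x := X 0 0 in let y := X 0 1 in let z := X 0 2 in
  \row_(i < 3) [:: y;
                   z ^+ 2 * sin x * cos x - sin x - eps * y;
                   alpha * (cos x - beta)]`_i.

Definition P0 beta : 'rV[R]_3 :=
  \row_(i < 3) [:: acos beta; 0; beta `^ (- (1 / 2))]`_i.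

Definition eps_c beta alpha : R := 2 * alpha * beta `^ (3 / 2).

Definition omega0 beta : R := Num.sqrt ((1 - beta ^+ 2) / beta).

(* [pder_form g [:: u_1; ...; u_k] X] is
   \sum_(j_1, ..., j_k) (u_1)_{j_1} ... (u_k)_{j_k}
                        (d^k g / dx_{j_1} ... dx_{j_k})(X),
   i.e. the k-th derivative of [g] at [X], extended to complex vectors. *)
Fixpoint pder_form (g : 'rV[R]_3 -> R) (us : seq 'cV[R[i]]_3)
    (X : 'rV[R]_3) : R[i] :=
  if us is u :: us' then
    \sum_(j < 3) u j 0 * pder_form (fun Y => 'D_(delta_mx 0 j) g Y) us' X
  else (g X)%:C%C.

End VectorField.

Definition cdot {R : realType} (u v : 'cV[R[i]]_3) : R[i] :=
  \sum_(i < 3) (u i 0)^*%C * v i 0.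

Definition conjv {R : realType} (u : 'cV[R[i]]_3) : 'cV[R[i]]_3 :=
  map_mx (@conjc R) u.

Section Lyapunov.
Context {R : realType} (beta alpha : R).

Local Notation C3 := 'cV[R[i]]_3.
Local Notation w0 := (omega0 beta).
Local Notation ec := (eps_c beta alpha).
Local Notation f := (vf beta alpha ec).

Definition jacA : 'M[R[i]]_3 := map_mx (real_complex R) ('J f (P0 beta))^T.

Definition mform (us : seq C3) : C3 :=
  \col_(i < 3) pder_form (fun X => f X 0 i) us (P0 beta).

Definition mformB (u v : C3) : C3 := mform [:: u; v].
Definition mformC (u v w : C3) : C3 := mform [:: u; v; w].
Definition mformD (u v w s : C3) : C3 := mform [:: u; v; w; s].
Definition mformE (u v w s t : C3) : C3 := mform [:: u; v; w; s; t].

Local Notation A := jacA.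
Local Notation B := mformB.
Local Notation C := mformC.
Local Notation D := mformD.
Local Notation E := mformE.
Local Notation ii := (Complex 0 1 : R[i]).
Local Notation iw0 := (ii * w0%:C%C).

Definition vq : C3 :=
  \col_(i < 3) [:: - ii; w0%:C%C; (ec / (2 * beta))%:C%C]`_i.

Definition vp : C3 :=
  \col_(i < 3) [:: - (ii / 2);
                   (w0%:C%C - ii * ec%:C%C) / (2 * (w0 ^+ 2 + ec ^+ 2))%:C%C;
                   beta%:C%C * (ec%:C%C + ii * w0%:C%C) /
                     (w0 ^+ 2 + ec ^+ 2)%:C%C]`_i.

Local Notation q := vq.
Local Notation p := vp.
Local Notation q' := (conjv vq).

Definition h11 : C3 := - (invmx A *m B q q').

Definition h20 : C3 := invmx ((2 * iw0)%:M - A) *m B q q.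

Definition h30 : C3 :=
  invmx ((3 * iw0)%:M - A) *m (3 *: B q h20 + C q q q).

Definition rhs21 : C3 := C q q q' + B q' h20 + 2 *: B q h11.

Definition G21 : R[i] := cdot p rhs21.

(* [xget] selects the element of this set, which is a singleton when
   0 < beta < 1 and 0 < alpha: i * omega0 is then a simple eigenvalue of A,
   with left and right eigenvectors p and q. *)
Definition h21 : C3 :=
  xget 0 [set h : C3 | (iw0%:M - A) *m h = rhs21 - G21 *: q
                       /\ cdot p h = 0]%classic.

Local Notation h20' := (conjv h20).
Local Notation h21' := (conjv h21).

Definition h31 : C3 :=
  invmx ((2 * iw0)%:M - A) *m
    (3 *: B q h21 + B q' h30 + 3 *: B h20 h11 + 3 *: C q q h11
     + 3 *: C q q' h20 + D q q q q' - (3 * G21) *: h20).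

Definition h22 : C3 :=
  - (invmx A *m
    (D q q q' q' + 4 *: C q q' h11 + C q' q' h20 + C q q h20'
     + 2 *: B h11 h11 + 2 *: B q h21' + 2 *: B q' h21 + B h20' h20)).

Definition G32 : R[i] :=
  cdot p
    (6 *: B h11 h21 + B h20' h30 + 3 *: B h21' h20 + 3 *: B q h22
     + 2 *: B q' h31 + 6 *: C q h11 h11 + 3 *: C q h20' h20
     + 3 *: C q q h21' + 6 *: C q q' h21 + 6 *: C q' h20 h11
     + C q' q' h30 + D q q q h20' + 6 *: D q q q' h11
     + 3 *: D q q' q' h20 + E q q q q' q').

Definition lyap2 : R := 1 / 12 * complex.Re G32.

End Lyapunov.

(* Main.v *)
(* In the coordinates U = (x - x0) / t, V = y / t, X = (z - z0) / (alpha s^2),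
   with s = sqrt beta and t = sin x0 = sqrt (1 - beta^2), and with time divided
   by beta, the Taylor coefficients of the vector field at P0 become polynomials
   in b = beta and g = alpha beta^(3/2), and q becomes a multiple of (b, j, j)
   with j = i beta omega0, j^2 = b^3 - b.  So every h_kl is the image under
   phase^k * conj(phase)^l * (the coordinate change) of a vector over Q(b, g)(j).
   Solving a linear system over Q(b, g)(j) amounts to rational identities modulo
   j^2 = b^3 - b, and since b and g are real while j is purely imaginary, the real
   part of G32 is, up to the real factor |phase|^4 / beta, its j-free part. *)

Require Import Defs.
From mathcomp Require Import all_boot all_order all_algebra.
From mathcomp Require Import complex ring lra.
From mathcomp Require Import all_classical all_reals all_analysis.

Import Order.TTheory GRing.Theory Num.Theory.
Import numFieldNormedType.Exports.

Local Open Scope ring_scope.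

(** * Column vectors of length three, coordinate by coordinate *)

Section Columns.
Context {K : pzRingType}.
Implicit Types (x y z : K) (u v : 'cV[K]_3).

Definition col3 x y z : 'cV[K]_3 := \col_(i < 3) [:: x; y; z]`_i.

Lemma col3E x y z :
  (col3 x y z 0 0 = x) * (col3 x y z 1 0 = y) * (col3 x y z 2 0 = z).
Proof. by rewrite !mxE. Qed.

Lemma col3P u v :
  u 0 0 = v 0 0 -> u 1 0 = v 1 0 -> u 2 0 = v 2 0 -> u = v.
Proof.
move=> e0 e1 e2; apply/colP; case=> -[|[|[|//]]] ltk.
- by rewrite (_ : Ordinal ltk = 0) //; apply: val_inj.
- by rewrite (_ : Ordinal ltk = 1) //; apply: val_inj.
- by rewrite (_ : Ordinal ltk = 2) //; apply: val_inj.
Qed.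

Lemma col3D x y z x' y' z' :
  col3 x y z + col3 x' y' z' = col3 (x + x') (y + y') (z + z').
Proof. by apply: col3P; rewrite !mxE. Qed.

Lemma col3N x y z : - col3 x y z = col3 (- x) (- y) (- z).
Proof. by apply: col3P; rewrite !mxE. Qed.

Lemma col3Z a x y z : a *: col3 x y z = col3 (a * x) (a * y) (a * z).
Proof. by apply: col3P; rewrite !mxE. Qed.

Lemma sum3 (f : 'I_3 -> K) : \sum_(i < 3) f i = f 0 + f 1 + f 2.
Proof.
rewrite !big_ord_recl big_ord0 addr0 addrA.
by congr (f _ + f _ + f _); apply: val_inj.
Qed.

End Columns.

(** * The vector field and its normal form data in the scaled coordinates *)

Section ScaledSystem.
Context {F : numFieldType} (b g : F).

Local Notation m := (1 - b ^+ 2).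
Local Notation D1 := (m + 4 * b * g ^+ 2).
Local Notation D2 := (m + b * g ^+ 2).
Local Notation D3 := (9 * m + 4 * b * g ^+ 2).

(* [scaled_shift l] is l - A in the scaled coordinates, and [scaledB] ... [scaledE]
   are the derivatives of orders 2 to 5 there; all are multiplied by b because of
   the rescaled time. *)
Definition scaled_shift (l : F) (u : 'cV[F]_3) : 'cV[F]_3 :=
  col3 (l * u 0 0 - b * u 1 0)
       (m * u 0 0 + (l + 2 * b * g) * u 1 0 - 2 * b * g * u 2 0)
       (m * u 0 0 + l * u 2 0).

Definition scaledB (u v : 'cV[F]_3) : 'cV[F]_3 :=
  col3 0
    (- (3 * b * m) * (u 0 0 * v 0 0)
     + 2 * g * (2 * b ^+ 2 - 1) * (u 0 0 * v 2 0 + u 2 0 * v 0 0)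
     + 2 * b * g ^+ 2 * (u 2 0 * v 2 0))
    (- (b * m) * (u 0 0 * v 0 0)).

Definition scaledC (u v w : 'cV[F]_3) : 'cV[F]_3 :=
  col3 0
    (m * (4 - 7 * b ^+ 2) * (u 0 0 * v 0 0 * w 0 0)
     - 8 * b * g * m * (u 0 0 * v 0 0 * w 2 0 + u 0 0 * v 2 0 * w 0 0
                        + u 2 0 * v 0 0 * w 0 0)
     + 2 * g ^+ 2 * (2 * b ^+ 2 - 1)
       * (u 0 0 * v 2 0 * w 2 0 + u 2 0 * v 0 0 * w 2 0 + u 2 0 * v 2 0 * w 0 0))
    (m ^+ 2 * (u 0 0 * v 0 0 * w 0 0)).

Definition scaledD (u v w s : 'cV[F]_3) : 'cV[F]_3 :=
  col3 0
    (15 * b * m ^+ 2 * (u 0 0 * v 0 0 * w 0 0 * s 0 0)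
     - 8 * g * m * (2 * b ^+ 2 - 1)
       * (u 0 0 * v 0 0 * w 0 0 * s 2 0 + u 0 0 * v 0 0 * w 2 0 * s 0 0
          + u 0 0 * v 2 0 * w 0 0 * s 0 0 + u 2 0 * v 0 0 * w 0 0 * s 0 0)
     - 8 * b * g ^+ 2 * m
       * (u 0 0 * v 0 0 * w 2 0 * s 2 0 + u 0 0 * v 2 0 * w 0 0 * s 2 0
          + u 2 0 * v 0 0 * w 0 0 * s 2 0 + u 0 0 * v 2 0 * w 2 0 * s 0 0
          + u 2 0 * v 0 0 * w 2 0 * s 0 0 + u 2 0 * v 2 0 * w 0 0 * s 0 0))
    (b * m ^+ 2 * (u 0 0 * v 0 0 * w 0 0 * s 0 0)).

Definition scaledE (u v w s t : 'cV[F]_3) : 'cV[F]_3 :=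
  col3 0
    (m ^+ 2 * (31 * b ^+ 2 - 16) * (u 0 0 * v 0 0 * w 0 0 * s 0 0 * t 0 0)
     + 32 * b * g * m ^+ 2
       * (u 0 0 * v 0 0 * w 0 0 * s 0 0 * t 2 0
          + u 0 0 * v 0 0 * w 0 0 * s 2 0 * t 0 0
          + u 0 0 * v 0 0 * w 2 0 * s 0 0 * t 0 0
          + u 0 0 * v 2 0 * w 0 0 * s 0 0 * t 0 0
          + u 2 0 * v 0 0 * w 0 0 * s 0 0 * t 0 0)
     - 8 * g ^+ 2 * m * (2 * b ^+ 2 - 1)
       * (u 0 0 * v 0 0 * w 0 0 * s 2 0 * t 2 0
          + u 0 0 * v 0 0 * w 2 0 * s 0 0 * t 2 0
          + u 0 0 * v 2 0 * w 0 0 * s 0 0 * t 2 0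
          + u 2 0 * v 0 0 * w 0 0 * s 0 0 * t 2 0
          + u 0 0 * v 0 0 * w 2 0 * s 2 0 * t 0 0
          + u 0 0 * v 2 0 * w 0 0 * s 2 0 * t 0 0
          + u 2 0 * v 0 0 * w 0 0 * s 2 0 * t 0 0
          + u 0 0 * v 2 0 * w 2 0 * s 0 0 * t 0 0
          + u 2 0 * v 0 0 * w 2 0 * s 0 0 * t 0 0
          + u 2 0 * v 2 0 * w 0 0 * s 0 0 * t 0 0))
    (- m ^+ 3 * (u 0 0 * v 0 0 * w 0 0 * s 0 0 * t 0 0)).

Definition scaled_q (j : F) : 'cV[F]_3 := col3 b j j.

(* The linear form <p, .> transported to the scaled coordinates, normalised to
   take the value 1 at [scaled_q j]. *)
Definition scaled_p (j : F) (u : 'cV[F]_3) : F :=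
  u 0 0 / (2 * b) + u 1 0 / (2 * (j + 2 * b * g))
  + b * g * u 2 0 / (j * (j + 2 * b * g)).

(* [sklU] and [sklX] are the first and third coordinates of the scaled h_kl.
   They come from solving the defining linear systems by exact arithmetic in
   Q(b, g)[j] / (j^2 - b^3 + b).  The second coordinate is then forced by the
   first row of [scaled_shift]. *)
Definition s11U : F := - b ^+ 3.

Definition s11X : F :=
  (b * m * (b - g ^+ 2)) / g.

Definition s20U (j : F) : F :=
  (b ^+ 2 * (3 * b - 3 * b ^+ 3 + (- 2 + 7 * b ^+ 2) * g ^+ 2)
   + j * (2 * b * g * (2 - 3 * b ^+ 2 + b * g ^+ 2)))
  / (3 * D2).

Definition s20X (j : F) : F :=
  (b * g * m * (- 2 + 3 * b ^+ 2 - b * g ^+ 2)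
   + j * (b * (3 * b - 3 * b ^+ 3 + (- 1 + 5 * b ^+ 2) * g ^+ 2)))
  / (3 * D2).

Definition s30U (j : F) : F :=
  (b ^+ 2 * (- 18 * b + 108 * b ^+ 3 - 162 * b ^+ 5 + 72 * b ^+ 7 + (- 81 +
     199 * b ^+ 2 - 47 * b ^+ 4 - 71 * b ^+ 6) * g ^+ 2 + (- 57 * b + 48 * b ^+ 3 +
     73 * b ^+ 5) * g ^+ 4 + (- 6 * b ^+ 2 + 6 * b ^+ 4) * g ^+ 6)
   + j * (b ^+ 2 * g * (207 * b - 468 * b ^+ 3 + 261 * b ^+ 5 + (- 63 + 437 * b ^+ 2
     - 438 * b ^+ 4) * g ^+ 2 + (- 33 * b + 97 * b ^+ 3) * g ^+ 4)))
  / (4 * D2 * D3).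

Definition s30X (j : F) : F :=
  (b ^+ 2 * g * m * (- 117 * b + 276 * b ^+ 3 - 159 * b ^+ 5 + (21 - 191 * b ^+ 2 +
     202 * b ^+ 4) * g ^+ 2 + (11 * b - 43 * b ^+ 3) * g ^+ 4)
   + j * (b * (- 18 * b + 108 * b ^+ 3 - 162 * b ^+ 5 + 72 * b ^+ 7 + (- 27 +
     25 * b ^+ 2 + 143 * b ^+ 4 - 141 * b ^+ 6) * g ^+ 2 + (- 19 * b + 67 * b ^+ 5)
     * g ^+ 4 + (- 2 * b ^+ 2 + 2 * b ^+ 4) * g ^+ 6)))
  / (4 * D2 * D3).

Definition sG21 (j : F) : F :=
  (3 * b ^+ 2 * g * m ^+ 2 * (- 3 * b + 5 * b ^+ 3 - g ^+ 2 - b * g ^+ 4)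
   + j * (b * (- 6 * b ^+ 3 + 12 * b ^+ 5 - 6 * b ^+ 7 + (- 1 - 17 * b ^+ 2 +
     21 * b ^+ 4 - 3 * b ^+ 6) * g ^+ 2 + (- 11 * b + 8 * b ^+ 3 - 13 * b ^+ 5) *
     g ^+ 4 + (- 10 * b ^+ 2 + 10 * b ^+ 4) * g ^+ 6)))
  / (3 * D1 * D2).

Definition s21U (j : F) : F :=
  (b ^+ 2 * (6 * b ^+ 3 - 18 * b ^+ 5 + 18 * b ^+ 7 - 6 * b ^+ 9 + (1 + 56 * b ^+ 2
     - 190 * b ^+ 4 + 208 * b ^+ 6 - 75 * b ^+ 8) * g ^+ 2 + (19 * b - 79 * b ^+ 3 +
     121 * b ^+ 5 - 61 * b ^+ 7) * g ^+ 4 + (- 22 * b ^+ 2 + 52 * b ^+ 4 -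
     78 * b ^+ 6) * g ^+ 6 + (- 40 * b ^+ 3 + 40 * b ^+ 5) * g ^+ 8)
   + j * (b ^+ 2 * g * (- 15 * b + 69 * b ^+ 3 - 93 * b ^+ 5 + 39 * b ^+ 7 + (1 +
     60 * b ^+ 2 - 101 * b ^+ 4 + 40 * b ^+ 6) * g ^+ 2 + (53 * b - 150 * b ^+ 3 +
     185 * b ^+ 5) * g ^+ 4 + (52 * b ^+ 2 - 84 * b ^+ 4) * g ^+ 6)))
  / (6 * D1 ^+ 2 * D2).

Definition s21X (j : F) : F :=
  (b ^+ 2 * g * m * (25 * b - 107 * b ^+ 3 + 139 * b ^+ 5 - 57 * b ^+ 7 + (5 -
     68 * b ^+ 2 + 83 * b ^+ 4 - 20 * b ^+ 6) * g ^+ 2 + (- 23 * b - 46 * b ^+ 3 +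
     45 * b ^+ 5) * g ^+ 4 + (- 28 * b ^+ 2 - 4 * b ^+ 4) * g ^+ 6)
   + j * (b * (- 6 * b + 36 * b ^+ 3 - 72 * b ^+ 5 + 60 * b ^+ 7 - 18 * b ^+ 9 + (3
     + 30 * b ^+ 2 - 94 * b ^+ 4 + 86 * b ^+ 6 - 25 * b ^+ 8) * g ^+ 2 + (49 * b -
     157 * b ^+ 3 + 235 * b ^+ 5 - 127 * b ^+ 7) * g ^+ 4 + (86 * b ^+ 2 -
     212 * b ^+ 4 + 174 * b ^+ 6) * g ^+ 6 + (40 * b ^+ 3 - 40 * b ^+ 5) * g ^+ 8)))
  / (6 * D1 ^+ 2 * D2).

Definition s31U (j : F) : F :=
  (b ^+ 3 * (1458%:R * b ^+ 2 - 7776%:R * b ^+ 4 + 16038%:R * b ^+ 6 -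
     14580%:R * b ^+ 8 + 2430%:R * b ^+ 10 + 5832%:R * b ^+ 12 - 4374%:R * b ^+ 14 +
     972 * b ^+ 16 + (8505%:R * b - 43569%:R * b ^+ 3 + 101349%:R * b ^+ 5 -
     150885%:R * b ^+ 7 + 163755%:R * b ^+ 9 - 124515%:R * b ^+ 11 +
     56439%:R * b ^+ 13 - 11079%:R * b ^+ 15) * g ^+ 2 + (1998%:R - 9501%:R * b ^+ 2
     + 99396%:R * b ^+ 4 - 362565%:R * b ^+ 6 + 576390%:R * b ^+ 8 -
     447183%:R * b ^+ 10 + 161496%:R * b ^+ 12 - 20031%:R * b ^+ 14) * g ^+ 4 + (-
     938 * b - 37979%:R * b ^+ 3 + 371859%:R * b ^+ 5 - 977974%:R * b ^+ 7 +
     1096628%:R * b ^+ 9 - 551247%:R * b ^+ 11 + 99651%:R * b ^+ 13) * g ^+ 6 + (-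
     14486%:R * b ^+ 2 + 34077%:R * b ^+ 4 + 121118%:R * b ^+ 6 - 309220%:R * b ^+ 8
     + 191208%:R * b ^+ 10 - 22697%:R * b ^+ 12) * g ^+ 8 + (- 6222%:R * b ^+ 3 +
     13194%:R * b ^+ 5 + 28422%:R * b ^+ 7 - 22578%:R * b ^+ 9 - 12816%:R * b ^+ 11)
     * g ^+ 10 + (9712%:R * b ^+ 4 - 43472%:R * b ^+ 6 + 65328%:R * b ^+ 8 -
     26832%:R * b ^+ 10) * g ^+ 12 + (4384%:R * b ^+ 5 - 14496%:R * b ^+ 7 +
     10112%:R * b ^+ 9) * g ^+ 14)
   + j * (b ^+ 2 * g * (- 1944%:R * b + 12933%:R * b ^+ 3 - 33048%:R * b ^+ 5 +
     39285%:R * b ^+ 7 - 17280%:R * b ^+ 9 - 6561%:R * b ^+ 11 + 9072%:R * b ^+ 13 -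
     2457%:R * b ^+ 15 + (36 + 9099%:R * b ^+ 2 - 68685%:R * b ^+ 4 +
     226032%:R * b ^+ 6 - 400518%:R * b ^+ 8 + 394971%:R * b ^+ 10 -
     203937%:R * b ^+ 12 + 43002%:R * b ^+ 14) * g ^+ 2 + (8128%:R * b -
     26403%:R * b ^+ 3 - 15630%:R * b ^+ 5 + 203708%:R * b ^+ 7 - 375234%:R * b ^+ 9
     + 285111%:R * b ^+ 11 - 79680%:R * b ^+ 13) * g ^+ 4 + (25512%:R * b ^+ 2 -
     153043%:R * b ^+ 4 + 352107%:R * b ^+ 6 - 356043%:R * b ^+ 8 +
     140377%:R * b ^+ 10 - 8910%:R * b ^+ 12) * g ^+ 6 + (24056%:R * b ^+ 3 -
     126929%:R * b ^+ 5 + 209547%:R * b ^+ 7 - 103811%:R * b ^+ 9 -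
     2863%:R * b ^+ 11) * g ^+ 8 + (15244%:R * b ^+ 4 - 37308%:R * b ^+ 6 -
     3132%:R * b ^+ 8 + 37548%:R * b ^+ 10) * g ^+ 10 + (12384%:R * b ^+ 5 -
     17872%:R * b ^+ 7 - 144 * b ^+ 9) * g ^+ 12 + (3776%:R * b ^+ 6 -
     3776%:R * b ^+ 8) * g ^+ 14)))
  / (36 * D1 ^+ 2 * D2 ^+ 3 * D3).

Definition s31X (j : F) : F :=
  (b ^+ 2 * g * m * (1620%:R * b - 9585%:R * b ^+ 3 + 18954%:R * b ^+ 5 -
     7695%:R * b ^+ 7 - 23760%:R * b ^+ 9 + 37665%:R * b ^+ 11 - 21870%:R * b ^+ 13
     + 4671%:R * b ^+ 15 + (- 126 + 1395%:R * b ^+ 2 - 2004%:R * b ^+ 4 -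
     27831%:R * b ^+ 6 + 107874%:R * b ^+ 8 - 154875%:R * b ^+ 10 +
     99984%:R * b ^+ 12 - 24417%:R * b ^+ 14) * g ^+ 2 + (- 6056%:R * b +
     38802%:R * b ^+ 3 - 112875%:R * b ^+ 5 + 142832%:R * b ^+ 7 - 48426%:R * b ^+ 9
     - 37818%:R * b ^+ 11 + 23541%:R * b ^+ 13) * g ^+ 4 + (- 22908%:R * b ^+ 2 +
     152561%:R * b ^+ 4 - 427770%:R * b ^+ 6 + 559176%:R * b ^+ 8 -
     330746%:R * b ^+ 10 + 69687%:R * b ^+ 12) * g ^+ 6 + (- 31492%:R * b ^+ 3 +
     170944%:R * b ^+ 5 - 360288%:R * b ^+ 7 + 313168%:R * b ^+ 9 -
     92332%:R * b ^+ 11) * g ^+ 8 + (- 24482%:R * b ^+ 4 + 86262%:R * b ^+ 6 -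
     104742%:R * b ^+ 8 + 37458%:R * b ^+ 10) * g ^+ 10 + (- 12816%:R * b ^+ 5 +
     25760%:R * b ^+ 7 - 12816%:R * b ^+ 9) * g ^+ 12 + (- 2848%:R * b ^+ 6 +
     2848%:R * b ^+ 8) * g ^+ 14)
   + j * (b ^+ 2 * (486 * b ^+ 2 - 972 * b ^+ 4 - 4374%:R * b ^+ 6 +
     19440%:R * b ^+ 8 - 31590%:R * b ^+ 10 + 26244%:R * b ^+ 12 -
     11178%:R * b ^+ 14 + 1944%:R * b ^+ 16 + (5427%:R * b - 26226%:R * b ^+ 3 +
     59085%:R * b ^+ 5 - 91980%:R * b ^+ 7 + 111645%:R * b ^+ 9 - 94482%:R * b ^+ 11
     + 45891%:R * b ^+ 13 - 9360%:R * b ^+ 15) * g ^+ 2 + (1269%:R +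
     2319%:R * b ^+ 2 + 13941%:R * b ^+ 4 - 97083%:R * b ^+ 6 + 158127%:R * b ^+ 8 -
     92727%:R * b ^+ 10 + 6903%:R * b ^+ 12 + 7251%:R * b ^+ 14) * g ^+ 4 + (893 * b
     - 8695%:R * b ^+ 3 + 133599%:R * b ^+ 5 - 375950%:R * b ^+ 7 +
     399811%:R * b ^+ 9 - 168051%:R * b ^+ 11 + 18393%:R * b ^+ 13) * g ^+ 6 + (-
     6529%:R * b ^+ 2 + 34773%:R * b ^+ 4 - 2966%:R * b ^+ 6 - 48530%:R * b ^+ 8 -
     489 * b ^+ 10 + 23741%:R * b ^+ 12) * g ^+ 8 + (- 5361%:R * b ^+ 3 +
     33660%:R * b ^+ 5 - 51966%:R * b ^+ 7 + 62988%:R * b ^+ 9 - 39321%:R * b ^+ 11)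
     * g ^+ 10 + (2312%:R * b ^+ 4 - 4696%:R * b ^+ 6 + 4440%:R * b ^+ 8 +
     3576%:R * b ^+ 10) * g ^+ 12 + (1520%:R * b ^+ 5 - 3936%:R * b ^+ 7 +
     2416%:R * b ^+ 9) * g ^+ 14)))
  / (36 * D1 ^+ 2 * D2 ^+ 3 * D3).

Definition s22U : F :=
  (b ^+ 4 * (- 9 * b - 27 * b ^+ 3 + 135 * b ^+ 5 - 153 * b ^+ 7 + 54 * b ^+ 9 + (-
     34 - 265 * b ^+ 2 + 836 * b ^+ 4 - 741 * b ^+ 6 + 204 * b ^+ 8) * g ^+ 2 + (-
     342 * b + 1262%:R * b ^+ 3 - 2394%:R * b ^+ 5 + 1474%:R * b ^+ 7) * g ^+ 4 + (-
     348 * b ^+ 2 + 1144%:R * b ^+ 4 - 1196%:R * b ^+ 6) * g ^+ 6 + (176 * b ^+ 3 -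
     176 * b ^+ 5) * g ^+ 8))
  / (9 * D1 ^+ 2 * D2).

Definition s22X : F :=
  (b ^+ 2 * m * (54 * b ^+ 2 - 144 * b ^+ 4 + 108 * b ^+ 6 - 18 * b ^+ 10 + (274 * b
     - 611 * b ^+ 3 + 505 * b ^+ 5 - 273 * b ^+ 7 + 105 * b ^+ 9) * g ^+ 2 + (- 4 +
     1352%:R * b ^+ 2 - 4596%:R * b ^+ 4 + 6552%:R * b ^+ 6 - 3304%:R * b ^+ 8) *
     g ^+ 4 + (- 309 * b + 3203%:R * b ^+ 3 - 6991%:R * b ^+ 5 + 4641%:R * b ^+ 7) *
     g ^+ 6 + (- 876 * b ^+ 2 + 2408%:R * b ^+ 4 - 2076%:R * b ^+ 6) * g ^+ 8 + (-
     544 * b ^+ 3 + 544 * b ^+ 5) * g ^+ 10))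
  / (9 * g * D1 ^+ 2 * D2).

(** With [g ^+ 2 = alpha ^+ 2 * b ^+ 3] the long factor of the numerator is [b ^+ 2] times the
    polynomial [h] of the theorem, and [D1], [D2], [D3] are the factors of its denominator. *)
Definition sG32re : F :=
  (b ^+ 3 * g * m ^+ 2 * (- 162 * b ^+ 2 + 486 * b ^+ 4 + 1134%:R * b ^+ 6 -
     7290%:R * b ^+ 8 + 13770%:R * b ^+ 10 - 12798%:R * b ^+ 12 + 5994%:R * b ^+ 14
     - 1134%:R * b ^+ 16 + (- 1998%:R * b - 549 * b ^+ 3 + 57816%:R * b ^+ 5 -
     210843%:R * b ^+ 7 + 346122%:R * b ^+ 9 - 301275%:R * b ^+ 11 +
     135756%:R * b ^+ 13 - 25029%:R * b ^+ 15) * g ^+ 2 + (- 540 - 20304%:R * b ^+ 2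
     + 113612%:R * b ^+ 4 - 229308%:R * b ^+ 6 + 215340%:R * b ^+ 8 -
     90392%:R * b ^+ 10 + 9540%:R * b ^+ 12 + 2052%:R * b ^+ 14) * g ^+ 4 + (-
     5533%:R * b - 31116%:R * b ^+ 3 + 284264%:R * b ^+ 5 - 758860%:R * b ^+ 7 +
     990831%:R * b ^+ 9 - 653360%:R * b ^+ 11 + 173774%:R * b ^+ 13) * g ^+ 6 + (-
     16022%:R * b ^+ 2 + 18694%:R * b ^+ 4 + 155856%:R * b ^+ 6 - 482464%:R * b ^+ 8
     + 517670%:R * b ^+ 10 - 193734%:R * b ^+ 12) * g ^+ 8 + (- 21205%:R * b ^+ 3 +
     67072%:R * b ^+ 5 - 60346%:R * b ^+ 7 - 17912%:R * b ^+ 9 + 33671%:R * b ^+ 11)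
     * g ^+ 10 + (- 14416%:R * b ^+ 4 + 46416%:R * b ^+ 6 - 58288%:R * b ^+ 8 +
     25648%:R * b ^+ 10) * g ^+ 12 + (- 4880%:R * b ^+ 5 + 11488%:R * b ^+ 7 -
     7248%:R * b ^+ 9) * g ^+ 14 + (- 640 * b ^+ 6 + 640 * b ^+ 8) * g ^+ 16))
  / (3 * D1 ^+ 3 * D2 ^+ 3 * D3).

Definition sG32im : F :=
  (b ^+ 2 * (2916%:R * b ^+ 2 - 28188%:R * b ^+ 4 + 113724%:R * b ^+ 6 -
     251748%:R * b ^+ 8 + 333396%:R * b ^+ 10 - 265356%:R * b ^+ 12 +
     115668%:R * b ^+ 14 - 16524%:R * b ^+ 16 - 5832%:R * b ^+ 18 +
     1944%:R * b ^+ 20 + (18468%:R * b - 117477%:R * b ^+ 3 + 169884%:R * b ^+ 5 +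
     509760%:R * b ^+ 7 - 2374380%:R * b ^+ 9 + 4175982%:R * b ^+ 11 -
     4073868%:R * b ^+ 13 + 2320056%:R * b ^+ 15 - 724680%:R * b ^+ 17 +
     96255%:R * b ^+ 19) * g ^+ 2 + (2223%:R + 164979%:R * b ^+ 2 -
     1569603%:R * b ^+ 4 + 6042381%:R * b ^+ 6 - 13081485%:R * b ^+ 8 +
     17879187%:R * b ^+ 10 - 16038969%:R * b ^+ 12 + 9283143%:R * b ^+ 14 -
     3165606%:R * b ^+ 16 + 483750%:R * b ^+ 18) * g ^+ 4 + (6244%:R * b +
     466658%:R * b ^+ 3 - 4107405%:R * b ^+ 5 + 14566712%:R * b ^+ 7 -
     28767971%:R * b ^+ 9 + 34870170%:R * b ^+ 11 - 26033379%:R * b ^+ 13 +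
     11022444%:R * b ^+ 15 - 2023473%:R * b ^+ 17) * g ^+ 6 + (- 94350%:R * b ^+ 2 +
     1552544%:R * b ^+ 4 - 7589827%:R * b ^+ 6 + 17824497%:R * b ^+ 8 -
     24212348%:R * b ^+ 10 + 20281522%:R * b ^+ 12 - 9929667%:R * b ^+ 14 +
     2167629%:R * b ^+ 16) * g ^+ 8 + (- 451128%:R * b ^+ 3 + 4047418%:R * b ^+ 5 -
     13125870%:R * b ^+ 7 + 20763572%:R * b ^+ 9 - 18108292%:R * b ^+ 11 +
     8899026%:R * b ^+ 13 - 2024726%:R * b ^+ 15) * g ^+ 10 + (- 811345%:R * b ^+ 4
     + 5395629%:R * b ^+ 6 - 13344218%:R * b ^+ 8 + 15690026%:R * b ^+ 10 -
     9243877%:R * b ^+ 12 + 2313785%:R * b ^+ 14) * g ^+ 12 + (- 714828%:R * b ^+ 5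
     + 3520016%:R * b ^+ 7 - 6327592%:R * b ^+ 9 + 4966224%:R * b ^+ 11 -
     1501164%:R * b ^+ 13) * g ^+ 14 + (- 306480%:R * b ^+ 6 + 1039888%:R * b ^+ 8 -
     1165968%:R * b ^+ 10 + 432560%:R * b ^+ 12) * g ^+ 16 + (- 50240%:R * b ^+ 7 +
     100480%:R * b ^+ 9 - 50240%:R * b ^+ 11) * g ^+ 18))
  / (36 * D1 ^+ 3 * D2 ^+ 3 * D3).

Definition scaled_h11 : 'cV[F]_3 := col3 s11U 0 s11X.
Definition scaled_h20 (j : F) : 'cV[F]_3 :=
  col3 (s20U j) (2 * j * s20U j / b) (s20X j).
Definition scaled_h30 (j : F) : 'cV[F]_3 :=
  col3 (s30U j) (3 * j * s30U j / b) (s30X j).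
(** The terms in [sG21 j], here and in [scaled_h31], come from the first coordinates of [G21 *: q]
    and [3 * G21 *: h20]; the derivatives of order at least 2 have first coordinate 0. *)
Definition scaled_h21 (j : F) : 'cV[F]_3 :=
  col3 (s21U j) (j * s21U j / b + sG21 j) (s21X j).
Definition scaled_h31 (j : F) : 'cV[F]_3 :=
  col3 (s31U j) ((2 * j * s31U j + 3 * sG21 j * s20U j) / b) (s31X j).
Definition scaled_h22 : 'cV[F]_3 := col3 s22U 0 s22X.

Definition scaled_rhs21 (j : F) : 'cV[F]_3 :=
  let q := scaled_q j in let q' := scaled_q (- j) in
  scaledC q q q' + scaledB q' (scaled_h20 j) + 2 *: scaledB q scaled_h11.

Definition scaled_rhs31 (j : F) : 'cV[F]_3 :=
  let q := scaled_q j in let q' := scaled_q (- j) in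
  3 *: scaledB q (scaled_h21 j) + scaledB q' (scaled_h30 j)
  + 3 *: scaledB (scaled_h20 j) scaled_h11 + 3 *: scaledC q q scaled_h11
  + 3 *: scaledC q q' (scaled_h20 j) + scaledD q q q q'
  - (3 * sG21 j) *: scaled_h20 j.

Definition scaled_rhs22 (j : F) : 'cV[F]_3 :=
  let q := scaled_q j in let q' := scaled_q (- j) in
  scaledD q q q' q' + 4 *: scaledC q q' scaled_h11
  + scaledC q' q' (scaled_h20 j) + scaledC q q (scaled_h20 (- j))
  + 2 *: scaledB scaled_h11 scaled_h11 + 2 *: scaledB q (scaled_h21 (- j))
  + 2 *: scaledB q' (scaled_h21 j) + scaledB (scaled_h20 (- j)) (scaled_h20 j).

Definition scaled_rhs32 (j : F) : 'cV[F]_3 :=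
  let q := scaled_q j in let q' := scaled_q (- j) in
  let h20 := scaled_h20 j in let h20' := scaled_h20 (- j) in
  let h21 := scaled_h21 j in let h21' := scaled_h21 (- j) in
  let h11 := scaled_h11 in let h30 := scaled_h30 j in
  6 *: scaledB h11 h21 + scaledB h20' h30 + 3 *: scaledB h21' h20
  + 3 *: scaledB q scaled_h22 + 2 *: scaledB q' (scaled_h31 j)
  + 6 *: scaledC q h11 h11 + 3 *: scaledC q h20' h20 + 3 *: scaledC q q h21'
  + 6 *: scaledC q q' h21 + 6 *: scaledC q' h20 h11 + scaledC q' q' h30
  + scaledD q q q h20' + 6 *: scaledD q q q' h11 + 3 *: scaledD q q' q' h20
  + scaledE q q q q' q'.

(** * Solvability and kernel of the scaled linear systems *)

Lemma scaled_shift_surj l :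
  b != 0 -> g != 0 -> l + 2 * b * g != 0 -> l ^+ 2 + b * m != 0 ->
  forall r, exists u, scaled_shift l u = r.
Proof.
move=> b0 g0 d1 d2 r.
(* Cramer's rule: the determinant of [scaled_shift l] is [(l + 2 * b * g) * (l ^+ 2 + b * m)]. The
   first row then gives the second coordinate, and the second row gives the third. *)
pose x := (2 * b ^+ 2 * g * r 2 0 + l * (l + 2 * b * g) * r 0 0 + l * b * r 1 0)
          / ((l + 2 * b * g) * (l ^+ 2 + b * m)).
pose y := (l * x - r 0 0) / b.
exists (col3 x y ((m * x + (l + 2 * b * g) * y - r 1 0) / (2 * b * g))).
apply: col3P; rewrite /scaled_shift !col3E.
- by rewrite /y; field.
- by field; rewrite ?b0 ?g0.
- by rewrite /y /x; field; rewrite ?b0 ?g0 ?d1 ?d2.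
Qed.

Lemma scaled_shift_inj j u :
  j ^+ 2 = b ^+ 3 - b -> b != 0 -> j != 0 -> j + 2 * b * g != 0 ->
  scaled_shift j u = 0 -> scaled_p j u = 0 -> u = 0.
Proof.
move=> j2 b0 j0 d1 /colP shu; have := shu 0; have := shu 2.
rewrite /scaled_shift !col3E !mxE => /eqP; rewrite addr_eq0 => /eqP e2.
move=> /eqP; rewrite subr_eq0 => /eqP e1.
have u1 : u 1 0 = j * u 0 0 / b by rewrite e1; field.
have u2 : u 2 0 = j * u 0 0 / b.
  apply: (mulfI j0); rewrite -[LHS]opprK -e2; field: j2 => //.
(* The two rows make [u] equal to [u 0 0 / b] times [scaled_q j], on which the linear form takes the
   value 1. *)
rewrite /scaled_p u1 u2 (_ : _ + _ + _ = u 0 0 / b); last by field; rewrite ?b0 ?j0 ?d1.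
move=> /eqP; rewrite mulf_eq0 invr_eq0 (negbTE b0) orbF => /eqP u0.
by apply: col3P; rewrite ?u1 ?u2 u0 ?mulr0 ?mul0r mxE.
Qed.

(** * Verification of the scaled solutions modulo j^2 = b^3 - b *)

Section Solutions.
Context (j : F).
Hypotheses (j2 : j ^+ 2 = b ^+ 3 - b) (b_neq0 : b != 0) (g_neq0 : g != 0).
Hypotheses (m_neq0 : m != 0) (D1_neq0 : D1 != 0) (D2_neq0 : D2 != 0).
Hypothesis D3_neq0 : D3 != 0.

Let j_neq0 : j != 0.
Proof.
suff : j ^+ 2 != 0 by rewrite expf_eq0.
by rewrite j2 (_ : _ - _ = - b * m); [rewrite mulf_neq0 ?oppr_eq0 | ring].
Qed.

(** Multiplying by the conjugate under [j -> - j] removes [j]: for [k = 1, 2, 3] the norm of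
    [k * j + 2 * b * g] is [b * D1], [4 * b * D2] and [b * D3]. Here [- 2 * b * g] is the real
    eigenvalue in scaled time. *)
Lemma shift1_neq0 : j + 2 * b * g != 0.
Proof.
suff : (j + 2 * b * g) * (2 * b * g - j) != 0 by rewrite mulf_eq0 negb_or => /andP[].
by rewrite (_ : _ * _ = b * D1); [rewrite mulf_neq0 | ring: j2].
Qed.

Lemma shift2_neq0 : 2 * j + 2 * b * g != 0.
Proof.
suff : (2 * j + 2 * b * g) * (2 * b * g - 2 * j) != 0.
  by rewrite mulf_eq0 negb_or => /andP[].
by rewrite (_ : _ * _ = 4 * b * D2); [rewrite !mulf_neq0 ?pnatr_eq0 | ring: j2].
Qed.

Lemma shift3_neq0 : 3 * j + 2 * b * g != 0.
Proof.
suff : (3 * j + 2 * b * g) * (2 * b * g - 3 * j) != 0.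
  by rewrite mulf_eq0 negb_or => /andP[].
by rewrite (_ : _ * _ = b * D3); [rewrite mulf_neq0 | ring: j2].
Qed.

Ltac unfold_solution := rewrite /scaled_shift /scaled_rhs21 /scaled_rhs31
  /scaled_rhs22 /scaled_rhs32 /scaled_q /scaled_h11 /scaled_h20 /scaled_h30
  /scaled_h21 /scaled_h31 /scaled_h22 /= /scaledB /scaledC /scaledD /scaledE
  ?col3E ?col3Z ?col3N ?col3D /scaled_p ?col3E.
(** Each coordinate is a rational identity in [b], [g], [j], checked by [field] modulo [j2]; the
    rewriting discharges the nonvanishing of the denominators. *)
Ltac solve_solution := rewrite /s11U /s11X /s20U /s20X /s30U /s30X /sG21 /s21U
  /s21X /s31U /s31X /s22U /s22X /sG32re /sG32im;
  field: j2; rewrite ?b_neq0 ?g_neq0 ?m_neq0 ?D1_neq0 ?D2_neq0 ?D3_neq0 ?j_neq0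
    ?shift1_neq0 ?pnatr_eq0 ?oner_eq0 //.
Ltac column := unfold_solution; congr col3; solve_solution.

Lemma scaled_h11P : scaled_shift 0 scaled_h11 = scaledB (scaled_q j) (scaled_q (- j)).
Proof. column. Qed.

Lemma scaled_h20P : scaled_shift (2 * j) (scaled_h20 j) = scaledB (scaled_q j) (scaled_q j).
Proof. column. Qed.

Lemma scaled_h30P : scaled_shift (3 * j) (scaled_h30 j)
  = 3 *: scaledB (scaled_q j) (scaled_h20 j)
    + scaledC (scaled_q j) (scaled_q j) (scaled_q j).
Proof. column. Qed.

Lemma scaled_G21P : scaled_p j (scaled_rhs21 j) = sG21 j.
Proof. unfold_solution; solve_solution. Qed.

Lemma scaled_h21P : scaled_shift j (scaled_h21 j) = scaled_rhs21 j - sG21 j *: scaled_q j.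
Proof. column. Qed.

Lemma scaled_p_h21 : scaled_p j (scaled_h21 j) = 0.
Proof. unfold_solution; solve_solution. Qed.

Lemma scaled_h31P : scaled_shift (2 * j) (scaled_h31 j) = scaled_rhs31 j.
Proof. column. Qed.

Lemma scaled_h22P : scaled_shift 0 scaled_h22 = scaled_rhs22 j.
Proof. column. Qed.

Lemma scaled_G32P : scaled_p j (scaled_rhs32 j) = sG32re + j * sG32im.
Proof. unfold_solution; solve_solution. Qed.

End Solutions.
End ScaledSystem.

(** * Transport of the scaled formulas along field morphisms *)

Section Morphism.
Context {F F' : numFieldType} (f : {rmorphism F -> F'}).

Lemma map_col3 x y z : map_mx f (col3 x y z) = col3 (f x) (f y) (f z).
Proof. by apply: col3P; rewrite !mxE. Qed.

Context (b g j : F) (b' g' j' : F').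
Hypotheses (fb : f b = b') (fg : f g = g') (fj : f j = j').

(** Used with the embedding of [R] into [R[i]]: the two parts of the scaled G32 are embedded real
    numbers. *)
Lemma map_sG32re : f (sG32re b g) = sG32re b' g'.
Proof. by rewrite -fb -fg /sG32re fmorph_div; congr (_ / _); ring. Qed.

Lemma map_sG32im : f (sG32im b g) = sG32im b' g'.
Proof. by rewrite -fb -fg /sG32im fmorph_div; congr (_ / _); ring. Qed.

(** Used with complex conjugation, which fixes [b] and [g] and sends [j] to [- j]. Besides [q], only
    [h20] and [h21] occur conjugated in the formulas. *)
Lemma map_scaled_h20 : map_mx f (scaled_h20 b g j) = scaled_h20 b' g' j'.
Proof.
have mapU : f (s20U b g j) = s20U b' g' j'.
  by rewrite -fb -fg -fj /s20U fmorph_div; congr (_ / _); ring.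
rewrite /scaled_h20 map_col3 -mapU; congr col3.
  by rewrite fmorph_div 2!rmorphM rmorph_nat fb fj.
by rewrite -fb -fg -fj /s20X fmorph_div; congr (_ / _); ring.
Qed.

Lemma map_scaled_h21 : map_mx f (scaled_h21 b g j) = scaled_h21 b' g' j'.
Proof.
have mapU : f (s21U b g j) = s21U b' g' j'.
  by rewrite -fb -fg -fj /s21U fmorph_div; congr (_ / _); ring.
have mapG : f (sG21 b g j) = sG21 b' g' j'.
  by rewrite -fb -fg -fj /sG21 fmorph_div; congr (_ / _); ring.
rewrite /scaled_h21 map_col3 -mapU -mapG; congr col3.
  by rewrite rmorphD fmorph_div rmorphM fb fj.
by rewrite -fb -fg -fj /s21X fmorph_div; congr (_ / _); ring.
Qed.

End Morphism.

(** * Partial derivatives of the vector field *)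

Section Derivatives.
Context {R : realType}.

Lemma is_derive_coord m n (M v : 'M[R]_(m.+1, n.+1)) i j :
  is_derive M v (fun N : 'M[R]_(m.+1, n.+1) => N i j) (v i j).
Proof.
apply: DeriveDef; first exact/diff_derivable/differentiable_coord.
have := @derive_mx R _ _ _ id M v (@derivable_id _ _ M v).
by rewrite derive_id => /matrixP/(_ i j); rewrite !mxE.
Qed.

(** Chain rule along a direction: the differential of [phi] is linear on [R], so at [dh] it is [dh]
    times its value at 1. *)
Lemma is_derive_comp_real (V : normedModType R) (h : V -> R) (phi : R -> R)
    (x v : V) (dh dphi : R) :
  differentiable h x -> is_derive x v h dh -> is_derive (h x) 1 phi dphi ->
  is_derive x v (phi \o h) (dphi * dh).
Proof.
move=> dif [_ <-] [/derivable1_diffP dif' <-].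
apply: DeriveDef; first exact/diff_derivable/differentiable_comp.
rewrite deriveE; last exact/differentiable_comp.
rewrite diff_comp //= !deriveE // -[in LHS](mulr1 ('d h x v)).
by rewrite -[_ * 1]/(_ *: 1) linearZ /= mulrC.
Qed.

(* This family contains the three components of the vector field and is closed
   under partial derivatives. *)
Definition fam (c0 c1 c2 a c e f y k : R) (X : 'rV[R]_3) : R :=
  (c0 + c1 * X 0 2 + c2 * X 0 2 ^+ 2)
  * (a * (sin (X 0 0) * cos (X 0 0)) + c * (cos (X 0 0) ^+ 2 - sin (X 0 0) ^+ 2))
  + (e * sin (X 0 0) + f * cos (X 0 0)) + y * X 0 1 + k.

Section FamCalculus.
Context (c0 c1 c2 a c e f y k : R) (X : 'rV[R]_3).
Let xc (N : 'rV[R]_3) : R := N 0 0.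
Let yc (N : 'rV[R]_3) : R := N 0 1.
Let zc (N : 'rV[R]_3) : R := N 0 2.

(** Pointwise operations become operations on functions, the form to which the rules for
    differentiability and [is_derive] apply. *)
Let famE : fam c0 c1 c2 a c e f y k =
  (cst c0 + cst c1 * zc + cst c2 * (zc * zc))
  * (cst a * ((sin \o xc) * (cos \o xc))
     + cst c * ((cos \o xc) * (cos \o xc) - (sin \o xc) * (sin \o xc)))
  + (cst e * (sin \o xc) + cst f * (cos \o xc)) + cst y * yc + cst k.
Proof. by apply/funext => N; rewrite /fam !fctE /= /xc /yc /zc !expr2. Qed.

Let diff_coord i : differentiable (fun N : 'rV[R]_3 => N 0 i) X.
Proof. exact: differentiable_coord. Qed.

Let diff_sin (x : R) : differentiable (@sin R) x.
Proof. exact/derivable1_diffP/derivable_sin. Qed.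

Let diff_cos (x : R) : differentiable (@cos R) x.
Proof. exact/derivable1_diffP/derivable_cos. Qed.

Lemma differentiable_fam : differentiable (fam c0 c1 c2 a c e f y k) X.
Proof.
have dS : differentiable (sin \o xc) X.
  by apply: differentiable_comp; [exact: diff_coord | exact: diff_sin].
have dC : differentiable (cos \o xc) X.
  by apply: differentiable_comp; [exact: diff_coord | exact: diff_cos].
have := diff_coord 2; have := diff_coord 1.
rewrite -/zc -/yc famE => dy dz.
do ![exact: differentiable_cst | exact: dS | exact: dC | exact: dy | exact: dz
    | apply: differentiableB | apply: differentiableD | apply: differentiableM].
Qed.

(** Since [sin * cos] has derivative [cos ^+ 2 - sin ^+ 2], whose derivative is [- 4 * sin * cos],
    the x-derivative sends [a, c] to [- 4 * c, a] and [e, f] to [- f, e]. The z-derivative acts on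
    the quadratic with coefficients [c0, c1, c2], and the y-derivative is the constant [y]. *)
Lemma is_derive_fam (v : 'rV[R]_3) :
  is_derive X v (fam c0 c1 c2 a c e f y k)
    (fam c0 c1 c2 (- 4 * c) a (- f) e 0 0 X * v 0 0
     + fam 0 0 0 0 0 0 0 0 y X * v 0 1
     + fam c1 (2 * c2) 0 a c 0 0 0 0 X * v 0 2).
Proof.
have dx : is_derive X v xc (v 0 0) := is_derive_coord _ _ X v 0 0.
have dy : is_derive X v yc (v 0 1) := is_derive_coord _ _ X v 0 1.
have dz : is_derive X v zc (v 0 2) := is_derive_coord _ _ X v 0 2.
have dS : is_derive X v (sin \o xc) (cos (X 0 0) * v 0 0).
  exact: is_derive_comp_real _ _ _ _ _ _ _ (diff_coord 0) dx (is_derive_sin _).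
have dC : is_derive X v (cos \o xc) (- sin (X 0 0) * v 0 0).
  exact: is_derive_comp_real _ _ _ _ _ _ _ (diff_coord 0) dx (is_derive_cos _).
rewrite famE; apply: is_derive_eq.
rewrite /fam !fctE /= /xc /yc /zc /GRing.scale /=; ring.
Qed.

Lemma derive_fam i :
  'D_(delta_mx 0 i) (fam c0 c1 c2 a c e f y k) X =
  [:: fam c0 c1 c2 (- 4 * c) a (- f) e 0 0 X; fam 0 0 0 0 0 0 0 0 y X;
      fam c1 (2 * c2) 0 a c 0 0 0 0 X]`_i.
Proof.
rewrite (@derive_val _ _ _ _ _ _ _ (is_derive_fam (delta_mx 0 i))) !mxE /=.
case: i => -[|[|[|//]]] lti /=; rewrite ?(mulr0, mulr1, addr0, add0r) //.
Qed.

End FamCalculus.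

End Derivatives.

(** * The multilinear forms of the vector field *)

Section Forms.
Context {R : realType}.

Lemma pder_fam_cons (c0 c1 c2 a c e f y k : R) u us X :
  pder_form (fam c0 c1 c2 a c e f y k) (u :: us) X =
  u 0 0 * pder_form (fam c0 c1 c2 (- 4 * c) a (- f) e 0 0) us X
  + u 1 0 * pder_form (fam 0 0 0 0 0 0 0 0 y) us X
  + u 2 0 * pder_form (fam c1 (2 * c2) 0 a c 0 0 0 0) us X.
Proof.
rewrite [LHS]/= sum3; congr (_ * _ + _ * _ + _ * _); congr pder_form;
  by apply/funext => Y; rewrite derive_fam.
Qed.

(** The factor in z is zero, so the function is the constant [k]. The induction needs [a] and [c]
    arbitrary because an x-derivative replaces them by [- 4 * c] and [a]. *)
Lemma pder_fam_cst (a c k : R) u us X :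
  pder_form (fam 0 0 0 a c 0 0 0 k) (u :: us) X = 0.
Proof.
elim: us u a c k => [|u' us IHus] u a c k; rewrite pder_fam_cons ?mulr0 ?oppr0.
  by rewrite /= /fam !(mul0r, add0r, addr0, mulr0).
by rewrite !IHus !mulr0 !addr0.
Qed.

(** The coordinate y enters affinely, so the y-branch dies as soon as another derivative follows,
    and two branches remain. *)
Lemma pder_fam_cons2 (c0 c1 c2 a c e f y k : R) u u' us X :
  pder_form (fam c0 c1 c2 a c e f y k) [:: u, u' & us] X =
  u 0 0 * pder_form (fam c0 c1 c2 (- 4 * c) a (- f) e 0 0) (u' :: us) X
  + u 2 0 * pder_form (fam c1 (2 * c2) 0 a c 0 0 0 0) (u' :: us) X.
Proof. by rewrite pder_fam_cons pder_fam_cst mulr0 addr0. Qed.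

Context (beta alpha : R).
Local Notation eps := (eps_c beta alpha).
Local Notation f := (vf beta alpha eps).

Lemma vf_fam :
  ((fun X => f X 0 0) = fam 0 0 0 0 0 0 0 1 0) *
  ((fun X => f X 0 1) = fam 0 0 1 1 0 (- 1) 0 (- eps) 0) *
  ((fun X => f X 0 2) = fam 0 0 0 0 0 0 alpha 0 (- alpha * beta)).
Proof. by do !split; apply/funext => X; rewrite mxE /fam /=; ring. Qed.

Lemma differentiable_vf X : differentiable f X.
Proof.
have -> : f = \sum_(i < 3) (fun X => f X 0 i *: delta_mx 0 i).
  by apply/funext => Y; rewrite fct_sumE [LHS]row_sum_delta.
apply: differentiable_sum => i; apply: differentiableZl.
case: i => -[|[|[|//]]] lti.
- rewrite (_ : Ordinal lti = 0); last exact: val_inj.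
  by rewrite vf_fam; apply: differentiable_fam.
- rewrite (_ : Ordinal lti = 1); last exact: val_inj.
  by rewrite vf_fam; apply: differentiable_fam.
- rewrite (_ : Ordinal lti = 2); last exact: val_inj.
  by rewrite vf_fam; apply: differentiable_fam.
Qed.

(** The Jacobian is the form of order 1, so [A] is computed by the same expansion as [B] to [E]. *)
Lemma jacA_mul u : jacA beta alpha *m u = mform beta alpha [:: u].
Proof.
apply/colP => i; rewrite !mxE; apply: eq_bigr => k _.
rewrite mulrC /= !mxE; congr (_ * _%:C%C).
have := deriveEjacobian (delta_mx 0 k) (differentiable_vf (P0 beta)).
rewrite derive_mx; last exact/diff_derivable/differentiable_vf.
by move/rowP/(_ i); rewrite -rowE !mxE.
Qed.

End Forms.

(** * The equilibrium and the parameters in terms of s = sqrt beta and t = sin x0 *)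

Section Chart.
Context {R : realType} (s t alpha : R).
Hypotheses (s_gt0 : 0 < s) (t_gt0 : 0 < t) (alpha_gt0 : 0 < alpha).
Implicit Types (u v w x y : 'cV[R[i]]_3) (z lam : R[i]).
Hypothesis t2 : t ^+ 2 = 1 - s ^+ 4.

Local Notation beta := (s ^+ 2).
Local Notation sC := (s%:C%C : R[i]).
Local Notation tC := (t%:C%C : R[i]).
Local Notation aC := (alpha%:C%C : R[i]).
Local Notation b := (sC ^+ 2).
Local Notation g := (aC * sC ^+ 3).
Local Notation ii := (Complex 0 1 : R[i]).
Local Notation j := (ii * sC * tC).

Lemma powR_sqr (x : R) : beta `^ x = s `^ (2 * x).
Proof. by rewrite powRrM powR_mulrn // ltW. Qed.

Lemma eps_cE : eps_c beta alpha = 2 * alpha * s ^+ 3.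
Proof.
rewrite /eps_c powR_sqr (_ : 2 * (3 / 2) = 3); last by field.
by rewrite powR_mulrn // ltW.
Qed.

Lemma omega0E : omega0 beta = t / s.
Proof.
rewrite /omega0 (_ : (1 - _) / _ = (t / s) ^+ 2).
  by rewrite sqrtr_sqr ger0_norm // divr_ge0 // ltW.
by rewrite expr_div_n t2; congr (_ / _); ring.
Qed.

Lemma beta_itv : -1 <= beta <= 1.
Proof.
have := exprn_gt0 2 t_gt0; have := exprn_gt0 2 s_gt0.
by rewrite t2 => *; apply/andP; split; nra.
Qed.

Lemma P0E : (P0 beta 0 2 = s^-1) * (cos (P0 beta 0 0) = s ^+ 2)
  * (sin (P0 beta 0 0) = t).
Proof.
do !split; rewrite mxE /=.
- rewrite powR_sqr (_ : 2 * - (1 / 2) = -1); last by field.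
  by rewrite powR_inv1 // ltW.
- by rewrite acosK // in_itv /= beta_itv.
- rewrite sin_acos ?beta_itv // (_ : 1 - _ = t ^+ 2); last by rewrite t2; ring.
  by rewrite sqrtr_sqr gtr0_norm.
Qed.

Let sC_neq0 : sC != 0. Proof. by rewrite eq_complex /= negb_and gt_eqF. Qed.
Let tC_neq0 : tC != 0. Proof. by rewrite eq_complex /= negb_and gt_eqF. Qed.
Let aC_neq0 : aC != 0. Proof. by rewrite eq_complex /= negb_and gt_eqF. Qed.
Let ii2 : ii ^+ 2 = -1. Proof. exact: sqr_i. Qed.
Let tC2 : tC ^+ 2 = 1 - sC ^+ 4.
Proof. by rewrite -!rmorphXn t2 rmorphB rmorph1. Qed.
Let j2 : j ^+ 2 = b ^+ 3 - b.
Proof. by ring: ii2 tC2. Qed.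

(** * The Jacobian and the forms B to E under the change of coordinates *)

Definition dilate (u : 'cV[R[i]]_3) : 'cV[R[i]]_3 :=
  col3 (tC * u 0 0) (tC * u 1 0) (aC * sC ^+ 2 * u 2 0).

(** Partial derivatives are evaluated at [P0] in terms of [s], [t] and [alpha]; the resulting
    identities hold modulo [t ^+ 2 = 1 - s ^+ 4]. *)
Ltac form_dilate :=
  apply: col3P; rewrite ![mform _ _ _ _ _]mxE !vf_fam ?pder_fam_cons2 ?pder_fam_cons;
  rewrite /pder_form /fam !P0E ?eps_cE; rewrite !mxE /=;
  field: tC2; rewrite ?sC_neq0 ?tC_neq0 //.

Lemma mform1_dilate z u :
  mform beta alpha [:: z *: dilate u] = (z / b) *: dilate (- scaled_shift b g 0 u).
Proof. form_dilate. Qed.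

Lemma mformB_dilate z1 z2 u v :
  mformB beta alpha (z1 *: dilate u) (z2 *: dilate v)
  = (z1 * z2 / b) *: dilate (scaledB b g u v).
Proof. rewrite /mformB. form_dilate. Qed.

Lemma mformC_dilate z1 z2 z3 u v w :
  mformC beta alpha (z1 *: dilate u) (z2 *: dilate v) (z3 *: dilate w)
  = (z1 * z2 * z3 / b) *: dilate (scaledC b g u v w).

Proof. rewrite /mformC. form_dilate. Qed.

Lemma mformD_dilate z1 z2 z3 z4 u v w x :
  mformD beta alpha (z1 *: dilate u) (z2 *: dilate v) (z3 *: dilate w)
    (z4 *: dilate x)
  = (z1 * z2 * z3 * z4 / b) *: dilate (scaledD b g u v w x).
Proof. rewrite /mformD. form_dilate. Qed.

Lemma mformE_dilate z1 z2 z3 z4 z5 u v w x y :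
  mformE beta alpha (z1 *: dilate u) (z2 *: dilate v) (z3 *: dilate w)
    (z4 *: dilate x) (z5 *: dilate y)
  = (z1 * z2 * z3 * z4 * z5 / b) *: dilate (scaledE b g u v w x y).
Proof. rewrite /mformE. form_dilate. Qed.

Lemma dilate_linear z u v : dilate (z *: u + v) = z *: dilate u + dilate v.
Proof. by apply: col3P; rewrite !mxE /=; ring. Qed.

(** The scalar for which [phase *: dilate (scaled_q b j)] is [q]; [phase'] is its conjugate. *)
Definition phase : R[i] := - ii / (tC * b).
Definition phase' : R[i] := ii / (tC * b).

Lemma phase_neq0 : phase != 0.
Proof.
by rewrite !mulf_neq0 ?invr_eq0 ?oppr_eq0 ?mulf_neq0 ?expf_neq0 // eq_complex /=
  negb_and oner_eq0 orbT.
Qed.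

Lemma phase_mul : phase * phase' = (((t * beta) ^+ 2)^-1)%:C%C.
Proof.
rewrite fmorphV !(rmorphXn, rmorphM) /phase /phase' /=.
by field: ii2; rewrite ?sC_neq0 ?tC_neq0.
Qed.

Let conjM (x y : R[i]) : conjc (x * y) = conjc x * conjc y.
Proof. exact: rmorphM. Qed.
Let conjN (x : R[i]) : conjc (- x) = - conjc x. Proof. exact: rmorphN. Qed.
Let conjV (x : R[i]) : conjc x^-1 = (conjc x)^-1. Proof. exact: fmorphV. Qed.
Let conjX (x : R[i]) n : conjc (x ^+ n) = conjc x ^+ n.
Proof. exact: rmorphXn. Qed.
Let conj_ii : conjc ii = - ii.
Proof. by apply/eqP; rewrite eq_complex /= oppr0 !eqxx. Qed.
Let conjE := (conjM, conjN, conjV, conjX, conj_ii, @conjc_real R).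

Lemma conj_phase : (conjc phase = phase') * (conjc phase' = phase).
Proof. by rewrite /phase /phase' !conjE !opprK. Qed.

(* [e] counts the factors 1 / beta produced by the rescaled time; [k] and [l] are
   the degrees in q and in its conjugate. *)
Definition chart (e k l : nat) (u : 'cV[R[i]]_3) : 'cV[R[i]]_3 :=
  (b ^- e * phase ^+ k * phase' ^+ l) *: dilate u.

Lemma chartD e k l u v : chart e k l u + chart e k l v = chart e k l (u + v).
Proof. by rewrite /chart -scalerDr -{1}[dilate u]scale1r -dilate_linear scale1r. Qed.

Lemma chartZ e k l z u :
  z *: chart e k l u = chart e k l (z *: u) :> 'cV[R[i]]_3.
Proof.
rewrite /chart; move: (_ * _) => w.
by apply: col3P; rewrite !mxE /=; ring.
Qed.

Lemma chartN e k l u : - chart e k l u = chart e k l (- u) :> 'cV[R[i]]_3.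
Proof. by rewrite -scaleN1r chartZ scaleN1r. Qed.

Lemma conj_chart e k l u : conjv (chart e k l u) = chart e l k (conjv u).
Proof.
apply: col3P; rewrite !mxE /= !(conj_phase, conjX, conjE); ring.
Qed.

(** Forms multiply the phases, so the degrees add, and the rescaled time contributes one factor
    [1 / b]. The same holds for [C], [D] and [E]. *)
Lemma mformB_chart k1 l1 k2 l2 u1 u2 :
  mformB beta alpha (chart 0 k1 l1 u1) (chart 0 k2 l2 u2)
  = chart 1 (k1 + k2) (l1 + l2) (scaledB b g u1 u2).
Proof.
rewrite mformB_dilate /chart !exprD expr0 expr1 invr1 !mul1r.
congr (_ *: _); move: (phase ^+ k1) (phase ^+ k2).
by move: (phase' ^+ l1) (phase' ^+ l2) => *; ring.
Qed.

Lemma mformC_chart k1 l1 k2 l2 k3 l3 u1 u2 u3 :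
  mformC beta alpha (chart 0 k1 l1 u1) (chart 0 k2 l2 u2) (chart 0 k3 l3 u3)
  = chart 1 (k1 + k2 + k3) (l1 + l2 + l3) (scaledC b g u1 u2 u3).
Proof.
rewrite mformC_dilate /chart !exprD expr0 expr1 invr1 !mul1r.
congr (_ *: _); move: (phase ^+ k1) (phase ^+ k2) (phase ^+ k3).
by move: (phase' ^+ l1) (phase' ^+ l2) (phase' ^+ l3) => *; ring.
Qed.

Lemma mformD_chart k1 l1 k2 l2 k3 l3 k4 l4 u1 u2 u3 u4 :
  mformD beta alpha (chart 0 k1 l1 u1) (chart 0 k2 l2 u2) (chart 0 k3 l3 u3)
    (chart 0 k4 l4 u4)
  = chart 1 (k1 + k2 + k3 + k4) (l1 + l2 + l3 + l4) (scaledD b g u1 u2 u3 u4).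
Proof.
rewrite mformD_dilate /chart !exprD expr0 expr1 invr1 !mul1r.
congr (_ *: _); move: (phase ^+ k1) (phase ^+ k2) (phase ^+ k3) (phase ^+ k4).
by move: (phase' ^+ l1) (phase' ^+ l2) (phase' ^+ l3) (phase' ^+ l4) => *; ring.
Qed.

Lemma mformE_chart k1 l1 k2 l2 k3 l3 k4 l4 k5 l5 u1 u2 u3 u4 u5 :
  mformE beta alpha (chart 0 k1 l1 u1) (chart 0 k2 l2 u2) (chart 0 k3 l3 u3)
    (chart 0 k4 l4 u4) (chart 0 k5 l5 u5)
  = chart 1 (k1 + k2 + k3 + k4 + k5) (l1 + l2 + l3 + l4 + l5)
      (scaledE b g u1 u2 u3 u4 u5).
Proof.
rewrite mformE_dilate /chart !exprD expr0 expr1 invr1 !mul1r.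
congr (_ *: _); move: (phase ^+ k1) (phase ^+ k2) (phase ^+ k3) (phase ^+ k4) (phase ^+ k5).
by move: (phase' ^+ l1) (phase' ^+ l2) (phase' ^+ l3) (phase' ^+ l4) (phase' ^+ l5) => *; ring.
Qed.

Lemma vq_chart : vq beta alpha = chart 0 1 0 (scaled_q b j).
Proof.
rewrite /chart expr0 invr1 expr1 mulr1 mul1r /phase.
apply: col3P; rewrite !mxE /= ?omega0E ?eps_cE;
  field: ii2; rewrite ?sC_neq0 ?tC_neq0 //.
Qed.

(** * The shifted Jacobian matrices and their inverses *)

Lemma iw0E : ii * (omega0 beta)%:C%C = j / b.
Proof. by rewrite omega0E rmorphM fmorphV /=; field. Qed.

(** Eigenvalues scale with time, so [lam] corresponds to [lam / b]. Applying the matrix keeps the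
    degrees and raises [e] from 0 to 1, as the forms do. *)
Lemma shift_chart lam k l u :
  ((lam / b)%:M - jacA beta alpha) *m chart 0 k l u
  = chart 1 k l (scaled_shift b g lam u).
Proof.
rewrite mulmxBl mul_scalar_mx jacA_mul /chart mform1_dilate.
move: (_ ^+ k) (_ ^+ l) => z z'.
by apply: col3P; rewrite !mxE /=; field; rewrite ?sC_neq0.
Qed.

(** Preimages of the basis vectors, taken as columns, form a right inverse. *)
Lemma surj_unitmx (M : 'M[R[i]]_3) :
  (forall r : 'cV[R[i]]_3, exists u : 'cV[R[i]]_3, M *m u = r) -> M \in unitmx.
Proof.
move=> surj; have [u Mu] := choice surj.
suff /mulmx1_unit[] : M *m \matrix_(i, k) u (col k 1%:M) i 0 = 1%:M by [].
apply/matrixP => i k; have /colP/(_ i) := Mu (col k 1%:M).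
by rewrite [RHS in _ = RHS -> _]mxE => <-; rewrite !mxE; apply: eq_bigr => x _; rewrite mxE.
Qed.

Lemma shift_unit lam :
  lam + 2 * b * g != 0 -> lam ^+ 2 + b * (1 - b ^+ 2) != 0 ->
  (lam / b)%:M - jacA beta alpha \in unitmx.
Proof.
move=> d1 d2; apply: surj_unitmx => r.
have b0 : b != 0 by rewrite expf_neq0.
have g0 : g != 0 by rewrite mulf_neq0 ?expf_neq0.
(* [chart 1 0 0] brings back [dilate] and a factor [1 / b], so [r] is multiplied by [b] and divided
   by the entries of [dilate]. *)
have [u uE] := scaled_shift_surj _ _ lam b0 g0 d1 d2
  (col3 (b * (r 0 0 / tC)) (b * (r 1 0 / tC)) (b * (r 2 0 / (aC * sC ^+ 2)))).
exists (chart 0 0 0 u); rewrite shift_chart uE /chart !expr0 expr1 !mulr1.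
by apply: col3P; rewrite !mxE /=; field; rewrite ?sC_neq0 ?tC_neq0 ?aC_neq0.
Qed.

Lemma solve_shift lam k l u r :
  scaled_shift b g lam u = r ->
  (lam / b)%:M - jacA beta alpha \in unitmx ->
  invmx ((lam / b)%:M - jacA beta alpha) *m chart 1 k l r = chart 0 k l u.
Proof. by move=> <- uM; rewrite -shift_chart mulKmx. Qed.

(** The case [lam = 0]: the matrix is then [- A], which accounts for the sign in front of [h11] and
    [h22]. *)
Lemma solve_jacA k l u r :
  scaled_shift b g 0 u = r -> (0 / b)%:M - jacA beta alpha \in unitmx ->
  - (invmx (jacA beta alpha) *m chart 1 k l r) = chart 0 k l u.
Proof.
move=> <-; rewrite -shift_chart mul0r raddf0 sub0r -scaleN1r unitmxZ ?unitrN1 // => uA.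
by rewrite scaleN1r mulNmx mulmxN opprK mulKmx.
Qed.

Lemma real_neq0 (x : R) : 0 < x -> (x%:C%C : R[i]) != 0.
Proof. by move=> x0; rewrite eq_complex /= negb_and gt_eqF. Qed.

Let m_neq0 : 1 - b ^+ 2 != 0.
Proof. by rewrite -exprM -tC2 expf_neq0. Qed.
Let b_neq0 : b != 0. Proof. by rewrite expf_neq0. Qed.
Let g_neq0 : g != 0. Proof. by rewrite mulf_neq0 ?expf_neq0. Qed.

(** Each of the three denominators is an embedded sum of positive reals. *)
Let D1_neq0 : 1 - b ^+ 2 + 4 * b * g ^+ 2 != 0.
Proof.
rewrite (_ : _ + _ = (t ^+ 2 + 4 * alpha ^+ 2 * s ^+ 8)%:C%C).
  by apply: real_neq0; rewrite addr_gt0 ?mulr_gt0 ?exprn_gt0.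
by ring: tC2.
Qed.
Let D2_neq0 : 1 - b ^+ 2 + b * g ^+ 2 != 0.
Proof.
rewrite (_ : _ + _ = (t ^+ 2 + alpha ^+ 2 * s ^+ 8)%:C%C).
  by apply: real_neq0; rewrite addr_gt0 ?mulr_gt0 ?exprn_gt0.
by ring: tC2.
Qed.
Let D3_neq0 : 9 * (1 - b ^+ 2) + 4 * b * g ^+ 2 != 0.
Proof.
rewrite (_ : _ + _ = (9 * t ^+ 2 + 4 * alpha ^+ 2 * s ^+ 8)%:C%C).
  by apply: real_neq0; rewrite addr_gt0 ?mulr_gt0 ?exprn_gt0.
by ring: tC2.
Qed.

Let unit0 : (0 / b)%:M - jacA beta alpha \in unitmx.
Proof.
apply: shift_unit; first by rewrite add0r !mulf_neq0 ?pnatr_eq0.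
by rewrite expr0n add0r mulf_neq0.
Qed.

(** No resonance: with m = 1 - b^2, the factor [lam ^+ 2 + b * m] is [- 3 * b * m] for [lam = 2 * j]
    and [- 8 * b * m] for [lam = 3 * j]. *)
Let unit2 : (2 * j / b)%:M - jacA beta alpha \in unitmx.
Proof.
apply: shift_unit; first exact: shift2_neq0 j2 b_neq0 D2_neq0.
have -> : (2 * j) ^+ 2 + b * (1 - b ^+ 2) = - 3 * b * (1 - b ^+ 2) by ring: j2.
by rewrite !mulf_neq0 // oppr_eq0 pnatr_eq0.
Qed.

Let unit3 : (3 * j / b)%:M - jacA beta alpha \in unitmx.
Proof.
apply: shift_unit; first exact: shift3_neq0 j2 b_neq0 D3_neq0.
have -> : (3 * j) ^+ 2 + b * (1 - b ^+ 2) = - 8 * b * (1 - b ^+ 2) by ring: j2.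
by rewrite !mulf_neq0 // oppr_eq0 pnatr_eq0.
Qed.

(** Since [p] takes the value 1 on [q], whose chart carries one [phase], pairing with [p] uses up
    one such factor: degree [k.+1] drops to [k]. *)
Lemma cdot_chart e k l u :
  cdot (vp beta alpha) (chart e k.+1 l u)
  = b ^- e * phase ^+ k * phase' ^+ l * scaled_p b g j u.
Proof.
have d1 := shift1_neq0 _ _ _ j2 b_neq0 D1_neq0.
have d1' : 2 * b * g - j != 0.
  suff : (j + 2 * b * g) * (2 * b * g - j) != 0.
    by rewrite mulf_eq0 negb_or => /andP[].
  have -> : (j + 2 * b * g) * (2 * b * g - j) = b * (1 - b ^+ 2 + 4 * b * g ^+ 2).
    by ring: j2.
  by rewrite mulf_neq0.
pose n2 : R := (t / s) ^+ 2 + (2 * alpha * s ^+ 3) ^+ 2.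
have vpE : vp beta alpha = col3 (- (ii / 2))
    ((tC / sC - ii * (2 * aC * sC ^+ 3)) / (2 * n2%:C%C))
    (b * (2 * aC * sC ^+ 3 + ii * (tC / sC)) / n2%:C%C).
  apply: col3P; rewrite !mxE // [nth _ _ _]/= omega0E eps_cE -/n2;
    by rewrite !(rmorphM, rmorphXn, fmorphV, rmorph_nat).
(* The sum of squares is a norm. After conjugation its factor [2 * b * g - j] cancels from the
   entries of [p], leaving the denominators of [scaled_p]. *)
have n2E : n2%:C%C = (j + 2 * b * g) * (2 * b * g - j) / b ^+ 2.
  by rewrite /n2; field: ii2; rewrite ?sC_neq0.
have conjD (x y : R[i]) : conjc (x + y) = conjc x + conjc y by exact: rmorphD.
rewrite vpE /cdot sum3 !col3E /chart [phase ^+ _]exprS /dilate.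
rewrite ![(_ *: col3 _ _ _) _ _]mxE !col3E.
rewrite !(conjD, conjX, conjE, conjc_nat) !n2E.
move: (phase ^+ k) (phase' ^+ l) (b ^- e) => z z' z''.
rewrite /scaled_p /phase.
field: ii2; apply/and5P; split=> //.
by rewrite eq_complex /= negb_and oner_eq0 orbT.
Qed.

(** * The vectors h_kl and the coefficients G21, G32 in the chart *)

Lemma conj_col3 (x y z : R[i]) :
  conjv (col3 x y z) = col3 (conjc x) (conjc y) (conjc z).
Proof. by apply: col3P; rewrite !mxE. Qed.

Let conj_b : conjc b = b. Proof. by rewrite !conjE. Qed.
Let conj_g : conjc g = g. Proof. by rewrite !conjE. Qed.
Let conj_j : conjc j = - j. Proof. by rewrite !conjE !mulNr. Qed.

Lemma conj_vq_chart : conjv (vq beta alpha) = chart 0 0 1 (scaled_q b (- j)).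
Proof.
by rewrite vq_chart conj_chart /scaled_q conj_col3 conj_b conj_j.
Qed.

Lemma h11_chart : h11 beta alpha = chart 0 1 1 (scaled_h11 b g).
Proof.
rewrite /h11 conj_vq_chart vq_chart mformB_chart.
by apply: solve_jacA unit0; apply: scaled_h11P.
Qed.

Lemma h20_chart : h20 beta alpha = chart 0 2 0 (scaled_h20 b g j).
Proof.
rewrite /h20 vq_chart mformB_chart iw0E mulrA.
by apply: solve_shift unit2; apply: scaled_h20P.
Qed.

Lemma h30_chart : h30 beta alpha = chart 0 3 0 (scaled_h30 b g j).
Proof.
rewrite /h30 h20_chart vq_chart mformB_chart mformC_chart chartZ chartD.
rewrite iw0E mulrA.
by apply: solve_shift unit3; apply: scaled_h30P.
Qed.

Lemma rhs21_chart : rhs21 beta alpha = chart 1 2 1 (scaled_rhs21 b g j).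
Proof.
rewrite /rhs21 conj_vq_chart h20_chart h11_chart vq_chart.
by rewrite !mformB_chart mformC_chart chartZ !chartD.
Qed.

Lemma G21_chart : G21 beta alpha = b ^- 1 * phase * phase' * sG21 b g j.
Proof.
rewrite /G21 rhs21_chart cdot_chart !expr1; congr (_ * _).
exact: scaled_G21P.
Qed.

(** [G21] carries one [phase], one [phase'] and one [1 / b], so the terms containing it land in the
    same chart as the other terms of their sums. *)
Lemma G21_scale k l u :
  G21 beta alpha *: chart 0 k l u = chart 1 k.+1 l.+1 (sG21 b g j *: u).
Proof.
rewrite -chartZ /chart G21_chart !scalerA; congr (_ *: _).
rewrite !exprS expr0 invr1.
by move: phase phase' (phase ^+ k) (phase' ^+ l) (sG21 _ _ _) => *; ring.
Qed.

(** Degree 1 in [q] supplies the factor [phase] that [cdot_chart] takes out. *)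
Lemma chart_surj u : exists v, u = chart 0 1 0 v.
Proof.
have p0 := phase_neq0.
exists (col3 (u 0 0 / (phase * tC)) (u 1 0 / (phase * tC))
             (u 2 0 / (phase * (aC * sC ^+ 2)))).
rewrite /chart expr0 invr1 expr1 mulr1 mul1r.
apply: col3P; rewrite !mxE /=; move: phase p0 => c c0; field;
  by rewrite ?c0 ?sC_neq0 ?tC_neq0 ?aC_neq0.
Qed.

Lemma chart_eq0 u : chart 1 1 0 u = 0 -> u = 0.
Proof.
have p0 := phase_neq0; rewrite /chart expr0 expr1 mulr1 => /colP du.
have a0 : aC * sC ^+ 2 != 0 by rewrite mulf_neq0 ?expf_neq0.
have bp0 : b ^-1 * phase != 0 by rewrite mulf_neq0 ?invr_eq0.
apply: col3P; [move: (du 0) | move: (du 1) | move: (du 2)];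
  rewrite expr1 mxE col3E !mxE => /eqP; rewrite !(mulf_eq0 _ (_ * _ 0));
  by rewrite (negbTE bp0) mulf_eq0 ?(negbTE tC_neq0) ?(negbTE a0) /= => /eqP.
Qed.

(* Otherwise unification compares different h_kl by unfolding them. *)
#[local] Opaque chart.

(** Uniqueness for [h21]: in the chart the two conditions become those of [scaled_shift_inj]. *)
Lemma bordered_inj u :
  ((j / b)%:M - jacA beta alpha) *m u = 0 -> cdot (vp beta alpha) u = 0 -> u = 0.
Proof.
have j0 : j != 0.
  by rewrite !mulf_neq0 // eq_complex /= negb_and oner_eq0 orbT.
have [v ->] := chart_surj u; rewrite shift_chart cdot_chart !expr0 invr1 !mul1r.
move=> /chart_eq0 shv pv; rewrite (scaled_shift_inj _ _ _ _ j2 b_neq0 j0 _ shv pv).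
  by rewrite -(scale0r (chart 0 0 0 0)) -chartZ !scale0r.
exact: shift1_neq0 j2 b_neq0 D1_neq0.
Qed.

Lemma h21_chart : h21 beta alpha = chart 0 2 1 (scaled_h21 b g j).
Proof.
have shift_h21 : ((j / b)%:M - jacA beta alpha) *m chart 0 2 1 (scaled_h21 b g j)
    = rhs21 beta alpha - G21 beta alpha *: vq beta alpha.
  rewrite shift_chart rhs21_chart vq_chart G21_scale chartN chartD.
  by congr chart; apply: scaled_h21P.
have p_h21 : cdot (vp beta alpha) (chart 0 2 1 (scaled_h21 b g j)) = 0.
  by rewrite cdot_chart scaled_p_h21 ?mulr0.
(* The set is a singleton, so the default 0 of [xget] does not arise: the difference of two
   solutions lies in the kernel and is annihilated by [p]. *)
apply: xget_unique; first by split=> //; rewrite iw0E.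
move=> y [] /=; rewrite iw0E -shift_h21 => eqy p_y.
apply: subr0_eq; apply: bordered_inj; first by rewrite mulmxBr eqy subrr.
rewrite -[RHS](subrr 0) -{1}p_y -p_h21 /cdot -sumrB.
by apply: eq_bigr => i _; rewrite !mxE mulrBr.
Qed.

Lemma conj_h20_chart :
  conjv (h20 beta alpha) = chart 0 0 2 (scaled_h20 b g (- j)).
Proof.
rewrite h20_chart conj_chart; congr chart.
exact: (map_scaled_h20 _ _ _ _ _ _ _ conj_b conj_g conj_j).
Qed.

Lemma conj_h21_chart :
  conjv (h21 beta alpha) = chart 0 1 2 (scaled_h21 b g (- j)).
Proof.
rewrite h21_chart conj_chart; congr chart.
exact: (map_scaled_h21 _ _ _ _ _ _ _ conj_b conj_g conj_j).
Qed.

(** Premises in the form of equations let [chart_sum] descend through a sum and pass the common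
    degrees to each summand. *)
Lemma chart_add e k l u v x y :
  x = chart e k l u -> y = chart e k l v -> x + y = chart e k l (u + v).
Proof. by move=> -> ->; apply: chartD. Qed.

Lemma chart_scale e k l z u x :
  x = chart e k l u -> z *: x = chart e k l (z *: u).
Proof. by move=> ->; apply: chartZ. Qed.

Lemma chart_opp e k l u x : x = chart e k l u -> - x = chart e k l (- u).
Proof. by move=> ->; apply: chartN. Qed.

Ltac chart_sum := do ![exact: mformB_chart | exact: mformC_chart
  | exact: mformD_chart | exact: mformE_chart | exact: G21_scale
  | apply: chart_add | apply: chart_scale | apply: chart_opp].

Lemma h31_chart : h31 beta alpha = chart 0 3 1 (scaled_h31 b g j).
Proof.
(* Splitting [3 * G21] exposes [G21 *: h20] to [G21_scale]. *)
rewrite /h31 iw0E mulrA -scalerA conj_vq_chart h30_chart h21_chart h20_chart.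
rewrite h11_chart vq_chart.
rewrite [X in _ *m X](_ : _ = chart 1 3 1 (scaled_rhs31 b g j)).
  by apply: solve_shift unit2; apply: scaled_h31P.
by rewrite /scaled_rhs31 -scalerA; chart_sum.
Qed.

Lemma h22_chart : h22 beta alpha = chart 0 2 2 (scaled_h22 b g).
Proof.
rewrite /h22 conj_h20_chart conj_h21_chart conj_vq_chart h21_chart h20_chart.
rewrite h11_chart vq_chart.
rewrite [X in _ *m X](_ : _ = chart 1 2 2 (scaled_rhs22 b g j)).
  by apply: solve_jacA unit0; apply: scaled_h22P.
by rewrite /scaled_rhs22; chart_sum.
Qed.

Lemma G32_chart : G32 beta alpha =
  (beta^-1 * ((t * beta) ^+ 2)^-1 ^+ 2)%:C%C * (sG32re b g + j * sG32im b g).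
Proof.
(* Pairing with [p] takes degrees 3, 2 to 2, 2, so [phase] and its conjugate occur equally often and
   the scalar is real. *)
have scalarE : b ^- 1 * phase ^+ 2 * phase' ^+ 2
    = (beta^-1 * ((t * beta) ^+ 2)^-1 ^+ 2)%:C%C.
  rewrite -mulrA -exprMn phase_mul expr1 !(rmorphM, rmorphXn, fmorphV) /=.
  by [].
rewrite /G32 conj_h20_chart conj_h21_chart conj_vq_chart h31_chart h22_chart.
rewrite h30_chart h21_chart h20_chart h11_chart vq_chart.
rewrite [X in cdot _ X](_ : _ = chart 1 3 2 (scaled_rhs32 b g j)).
  by rewrite cdot_chart; apply: congr2; [exact: scalarE | apply: scaled_G32P].
by rewrite /scaled_rhs32; chart_sum.
Qed.

Lemma lyap2E : lyap2 beta alpha =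
  sG32re beta (alpha * s ^+ 3) / (12 * beta * (t * beta) ^+ 4).
Proof.
have bE : real_complex R beta = b by rewrite rmorphXn.
have gE : real_complex R (alpha * s ^+ 3) = g by rewrite rmorphM rmorphXn.
(* The shape of [G32_chart] with embedded reals: the product with [ii] is purely imaginary and drops
   out. *)
have ReE (x y u v z : R) :
    complex.Re (x%:C%C * (y%:C%C + ii * u%:C%C * v%:C%C * z%:C%C)) = x * y.
  by rewrite /=; ring.
have := G32_chart.
rewrite -(map_sG32re _ _ _ _ _ bE gE) -(map_sG32im _ _ _ _ _ bE gE).
rewrite /lyap2; move: (G32 _ _) (sG32re _ _) (sG32im _ _) => G z z' ->.
by rewrite ReE; field; rewrite !gt_eqF.
Qed.

End Chart.

(** * Return to beta and comparison with the stated polynomial *)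

Theorem theorem4p2 (R : realType) (beta alpha : R)
    (hbeta0 : 0 < beta) (hbeta1 : beta < 1) (halpha : 0 < alpha) :
  let h : R :=
    - 162%:R - 54%:R * (- 9%:R + 37%:R * alpha ^+ 2) * beta ^+ 2
    - 9%:R * (- 126%:R + 61%:R * alpha ^+ 2 + 60%:R * alpha ^+ 4) * beta ^+ 4
    - 18%:R * (405%:R - 3212%:R * alpha ^+ 2 + 1128%:R * alpha ^+ 4) * beta ^+ 6
    + (13770%:R - 210843%:R * alpha ^+ 2 + 113612%:R * alpha ^+ 4 - 5533%:R * alpha ^+ 6)
      * beta ^+ 8
    - 6%:R * (2133%:R - 57687%:R * alpha ^+ 2 + 38218%:R * alpha ^+ 4
              + 5186%:R * alpha ^+ 6) * beta ^+ 10
    + (5994%:R - 301275%:R * alpha ^+ 2 + 215340%:R * alpha ^+ 4 + 284264%:R * alpha ^+ 6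
       - 16022%:R * alpha ^+ 8) * beta ^+ 12
    + 2%:R * (- 567%:R + 67878%:R * alpha ^+ 2 - 45196%:R * alpha ^+ 4
              - 379430%:R * alpha ^+ 6 + 9347%:R * alpha ^+ 8) * beta ^+ 14
    + alpha ^+ 2 * (- 25029%:R + 9540%:R * alpha ^+ 2 + 990831%:R * alpha ^+ 4
                + 155856%:R * alpha ^+ 6 - 21205%:R * alpha ^+ 8) * beta ^+ 16
    + 4%:R * alpha ^+ 4
      * (513%:R - alpha ^+ 2 * (163340%:R + 120616%:R * alpha ^+ 2
                            - 16768%:R * alpha ^+ 4)) * beta ^+ 18
    - 2%:R * alpha ^+ 6 * (- 86887%:R - 258835%:R * alpha ^+ 2 + 30173%:R * alpha ^+ 4
                       + 7208%:R * alpha ^+ 6) * beta ^+ 20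
    + 2%:R * alpha ^+ 8 * (- 96867%:R - 8956%:R * alpha ^+ 2 + 23208%:R * alpha ^+ 4)
      * beta ^+ 22
    + alpha ^+ 10 * (33671%:R - 58288%:R * alpha ^+ 2 - 4880%:R * alpha ^+ 4) * beta ^+ 24
    + 16%:R * alpha ^+ 12 * (1603%:R + 718%:R * alpha ^+ 2) * beta ^+ 26
    - 16%:R * alpha ^+ 14 * (453%:R + 40%:R * alpha ^+ 2) * beta ^+ 28
    + 640%:R * alpha ^+ 16 * beta ^+ 30 in
  lyap2 beta alpha =
    alpha * beta `^ (3 / 2) * h /
    (36 * (1 - beta ^+ 2 + alpha ^+ 2 * beta ^+ 4) ^+ 3
        * (9 - 9 * beta ^+ 2 + 4 * alpha ^+ 2 * beta ^+ 4)
        * (1 - beta ^+ 2 + 4 * alpha ^+ 2 * beta ^+ 4) ^+ 3).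
Proof.
move=> h.
pose s := Num.sqrt beta; pose t := Num.sqrt (1 - beta ^+ 2).
have s_gt0 : 0 < s by rewrite sqrtr_gt0.
have beta2_lt1 : 0 < 1 - beta ^+ 2 by rewrite subr_gt0 expr_lt1 // ltW.
have t_gt0 : 0 < t by rewrite sqrtr_gt0.
have betaE : beta = s ^+ 2 by rewrite sqr_sqrtr // ltW.
have t2 : t ^+ 2 = 1 - s ^+ 4 by rewrite sqr_sqrtr ?ltW // betaE -exprM.
(* From here [beta] is [s ^+ 2], and [s] and [t] are variables tied by [t ^+ 2 = 1 - s ^+ 4]. *)
clearbody s t; subst beta.
have d1 : 1 - s ^+ 4 + alpha ^+ 2 * s ^+ 8 != 0.
  by rewrite -t2 gt_eqF // addr_gt0 // mulr_gt0 ?exprn_gt0.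
have d2 : 9 - 9 * s ^+ 4 + 4 * alpha ^+ 2 * s ^+ 8 != 0.
  rewrite (_ : 9 - _ = 9 * t ^+ 2); last by rewrite t2; ring.
  by rewrite gt_eqF // addr_gt0 // !mulr_gt0 ?exprn_gt0.
have d3 : 1 - s ^+ 4 + 4 * alpha ^+ 2 * s ^+ 8 != 0.
  by rewrite -t2 gt_eqF // addr_gt0 // !mulr_gt0 ?exprn_gt0.
have t4 : t ^+ 4 = (1 - s ^+ 4) ^+ 2 by rewrite -t2 -exprM.
have d4 : 1 - s ^+ 4 != 0 by rewrite -t2 expf_neq0 // gt_eqF.
rewrite (lyap2E _ _ _ s_gt0 t_gt0 halpha t2) powR_sqr //.
rewrite (_ : 2 * (3 / 2) = 3); last by field.
(* The factor [b ^+ 5 * (1 - b ^+ 2) ^+ 2] of the numerator of [sG32re] cancels [beta ^+ 5 * t ^+ 4]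
   in the denominator of [lyap2E]. *)
rewrite powR_mulrn ?ltW // exprMn t4 /h /sG32re.
by field; apply/and5P; split; rewrite -?exprM // gt_eqF.
Qed.
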